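(* Let $(N,[\cdot,\dots,\cdot],\alpha)$ be an $n$-ary multiplicative Hom-Nambu-Lie superalgebra. Let $\mathcal{L}(N)=\wedge^{n-1}N$ with the induced $\mathbb{Z}_2$-grading, let $\widetilde{\alpha}:\mathcal{L}(N)\to\mathcal{L}(N)$ be given by $\widetilde{\alpha}(x_1\wedge\dots\wedge x_{n-1})=\alpha(x_1)\wedge\dots\wedge\alpha(x_{n-1})$, and let $[\cdot,\cdot]_\alpha$ be the even bilinear map on $\mathcal{L}(N)$ given for homogeneous $x=x_1\wedge\dots\wedge x_{n-1}$, $y=y_1\wedge\dots\wedge y_{n-1}$ by $$[x,y]_\alpha=\sum_{i=1}^{n-1}(-1)^{|x||y^i|}\ \alpha(y_1)\wedge\dots\wedge\alpha(y_{i-1})\wedge [x_1,\dots,x_{n-1},y_i]\wedge\alpha(y_{i+1})\wedge\dots\wedge\alpha(y_{n-1}),$$ where $|x|=\sum_{j=1}^{n-1}|x_j|$ and $|y^i|=\sum_{j=1}^{i-1}|y_j|$. Then the triple $(\mathcal{L}(N),[\cdot,\cdot]_\alpha,\widetilde{\alpha})$ is a Hom-Leibniz superalgebra.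
   Context: The base field is algebraically closed of characteristic zero. An $n$-ary multiplicative Hom-Nambu-Lie superalgebra $(N,[\cdot,\dots,\cdot],\alpha)$ consists of a $\mathbb{Z}_2$-graded vector space $N=N_0\oplus N_1$, an even $n$-linear map $[\cdot,\dots,\cdot]:N^n\to N$ (so $[N_{j_1},\dots,N_{j_n}]\subset N_{j_1+\dots+j_n}$) and an even linear map $\alpha:N\to N$ such that, for all homogeneous elements: (i) (super-Hom-Nambu identity) $$[\alpha(x_1),\dots,\alpha(x_{n-1}),[y_1,\dots,y_n]]=\sum_{i=1}^{n}(-1)^{|x||y^i|}[\alpha(y_1),\dots,\alpha(y_{i-1}),[x_1,\dots,x_{n-1},y_i],\alpha(y_{i+1}),\dots,\alpha(y_n)],$$ with $|x|=\sum_{j=1}^{n-1}|x_j|$, $|y^i|=\sum_{j=1}^{i-1}|y_j|$; (ii) (super-skew-symmetry) the bracket is super-skew-symmetric, i.e. exchanging two arguments $x_i,x_j$ multiplies it by $-(-1)^{|x_i||x_j|}$ (together with the usual Koszul signs for intermediate arguments); (iii) (multiplicativity) $\alpha([x_1,\dots,x_n])=[\alpha(x_1),\dots,\alpha(x_n)]$. $\wedge^{n-1}N$ is the (super) exterior power, i.e. elements $x_1\wedge\dots\wedge x_{n-1}$ are super-skew-symmetric in their arguments. A Hom-Leibniz superalgebra is a triple $(\mathcal{A},[\cdot,\cdot],\alpha)$ with $\mathcal{A}$ a $\mathbb{Z}_2$-graded vector space, $[\cdot,\cdot]$ an even bilinear map and $\alpha$ an even linear map such that for all homogeneous $x,y,z$: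 $[[x,y],\alpha(z)]=[\alpha(x),[y,z]]-(-1)^{|x||y|}[\alpha(y),[x,z]]$. *)

(* Defs.v *)
From HB Require Import structures.
From mathcomp Require Import all_boot all_algebra all_fingroup.
From mathcomp Require Import sesquilinear ring_quotient generic_quotient.
From mathcomp Require Import boolp.
From mathcomp Require Export freeg.

Set Implicit Arguments.
Unset Strict Implicit.
Unset Printing Implicit Defensive.

Import GRing.Theory.
Local Open Scope ring_scope.

Inductive lspan (K : fieldType) (V : lmodType K) (S : V -> Prop) : V -> Prop :=
| lspan_zero : lspan S 0
| lspan_cons a u v : S u -> lspan S v -> lspan S (a *: u + v).

Definition subspace_prop (K : fieldType) (V : lmodType K) (S : V -> Prop) :=
  S 0 /\ forall a u v, S u -> S v -> S (a *: u + v).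

(* Degrees in Z/2 are booleans: addb is the sum and andb the product, and the
   sign (-1)^d is (-1) ^+ d through the coercion of bool to nat. *)
Definition is_grading (K : fieldType) (V : lmodType K) (gr : bool -> V -> Prop) :=
  [/\ forall d, subspace_prop (gr d),
      forall v, exists v0 v1, [/\ gr false v0, gr true v1 & v = v0 + v1]
    & forall v, gr false v -> gr true v -> v = 0].

Definition even_map (K : fieldType) (V W : lmodType K)
    (grV : bool -> V -> Prop) (grW : bool -> W -> Prop) (f : V -> W) :=
  forall d v, grV d v -> grW d (f v).

Section Tuples.
Variables (K : fieldType) (N : lmodType K) (gr : bool -> N -> Prop).

Definition homog_at p (d : 'I_p -> bool) (x : {ffun 'I_p -> N}) :=
  forall i, gr (d i) (x i).

Definition total p (d : 'I_p -> bool) : bool := \big[addb/false]_i d i.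

Definition total_lt p (d : 'I_p -> bool) (i : 'I_p) : bool :=
  \big[addb/false]_(j : 'I_p | (j < i)%N) d j.

Definition total_between p (d : 'I_p -> bool) (i j : 'I_p) : bool :=
  \big[addb/false]_(k : 'I_p | (i < k < j)%N) d k.

Definition upd p (x : {ffun 'I_p -> N}) (i : 'I_p) (v : N) : {ffun 'I_p -> N} :=
  [ffun k => if k == i then v else x k].

Definition swap p (x : {ffun 'I_p -> N}) (i j : 'I_p) : {ffun 'I_p -> N} :=
  [ffun k => x (tperm i j k)].

(* x_1, ..., x_p, v *)
Definition ffrcons p (x : {ffun 'I_p -> N}) (v : N) : {ffun 'I_p.+1 -> N} :=
  [ffun k => if unlift ord_max k is Some l then x l else v].

(* Koszul sign of the exchange of the arguments i < j: the two elements pass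
   each other (together with the skew sign) and each passes those in between. *)
Definition swap_sign p (d : 'I_p -> bool) (i j : 'I_p) : K :=
  - (-1) ^+ (d i && d j) * (-1) ^+ ((d i (+) d j) && total_between d i j).

Definition multilinear p (V : lmodType K) (f : {ffun 'I_p -> N} -> V) :=
  forall x i a u v,
    f (upd x i (a *: u + v)) = a *: f (upd x i u) + f (upd x i v).

Definition super_skew p (V : lmodType K) (f : {ffun 'I_p -> N} -> V) :=
  forall d x (i j : 'I_p), homog_at d x -> (i < j)%N ->
    f (swap x i j) = swap_sign d i j *: f x.

End Tuples.

(* The super exterior power: the free vector space on the p-tuples of elements
   of N, modulo multilinearity and super-skew-symmetry. *)
Section SuperExteriorPower.
Variables (K : fieldType) (N : lmodType K) (gr : bool -> N -> Prop) (p : nat).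

Let T := {ffun 'I_p -> N}.

Definition free_tuple (x : T) : {freeg T / K} := [freeg [:: (1, x)]].

Inductive superext_gen : {freeg T / K} -> Prop :=
| superext_gen_lin x i a u v :
    superext_gen (free_tuple (upd x i (a *: u + v))
                  - (a *: free_tuple (upd x i u) + free_tuple (upd x i v)))
| superext_gen_skew d x (i j : 'I_p) : homog_at gr d x -> (i < j)%N ->
    superext_gen (free_tuple (swap x i j) - swap_sign K d i j *: free_tuple x).

Definition superext_rel : {pred {freeg T / K}} :=
  fun u => `[< lspan superext_gen u >].

Lemma superext_relP u : reflect (lspan superext_gen u) (u \in superext_rel).
Proof. exact: asboolP. Qed.

Lemma superext_rel_submod : submod_closed superext_rel.
Proof.
split=> [|a u v]; first by apply/superext_relP; constructor.
move=> /superext_relP Hu /superext_relP Hv; apply/superext_relP.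
elim: Hu => [|b g w Hg _ IH]; first by rewrite scaler0 add0r.
by rewrite scalerDr scalerA -addrA; constructor.
Qed.

HB.instance Definition _ :=
  GRing.isSubmodClosed.Build K {freeg T / K} superext_rel superext_rel_submod.

Definition superext := Quotient.quot superext_rel.
HB.instance Definition _ := GRing.Zmodule.on superext.

Definition superext_pi (u : {freeg T / K}) : superext :=
  \pi_(Quotient.quot superext_rel)%qT u.

Lemma superext_pi_eq u v :
  superext_pi u = superext_pi v <-> u - v \in superext_rel.
Proof. by rewrite Quotient.idealrBE; split=> [h|/eqP]; first exact/eqP. Qed.

Lemma superext_pi_surj (w : superext) : exists u, superext_pi u = w.
Proof. by exists (repr w); exact: reprK. Qed.

Lemma superext_piD u v : superext_pi (u + v) = superext_pi u + superext_pi v.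
Proof. exact: raddfD. Qed.

Definition superext_scale (a : K) (w : superext) : superext :=
  superext_pi (a *: repr (w : Quotient.quot superext_rel)).

Lemma superext_piZ a u : superext_pi (a *: u) = superext_scale a (superext_pi u).
Proof.
apply/superext_pi_eq; rewrite -scalerBr rpredZ //.
by rewrite Quotient.idealrBE reprK.
Qed.

Fact superext_scaleA a b w :
  superext_scale a (superext_scale b w) = superext_scale (a * b) w.
Proof.
by case: (superext_pi_surj w) => u <-; rewrite -!superext_piZ scalerA.
Qed.

Fact superext_scale1 : left_id 1 superext_scale.
Proof.
by move=> w; case: (superext_pi_surj w) => u <-; rewrite -superext_piZ scale1r.
Qed.

Fact superext_scaleDr : right_distributive superext_scale +%R.
Proof.
move=> a v w; case: (superext_pi_surj v) => s <-.
case: (superext_pi_surj w) => t <-.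
by rewrite -superext_piD -!superext_piZ scalerDr superext_piD.
Qed.

Fact superext_scaleDl w : {morph superext_scale^~ w : a b / a + b}.
Proof.
move=> a b /=; case: (superext_pi_surj w) => s <-.
by rewrite -!superext_piZ scalerDl superext_piD.
Qed.

HB.instance Definition _ := GRing.Zmodule_isLmodule.Build K superext
  superext_scaleA superext_scale1 superext_scaleDr superext_scaleDl.

Fact superext_pi_is_linear : linear superext_pi.
Proof. by move=> a u v; rewrite superext_piD superext_piZ. Qed.

HB.instance Definition _ :=
  GRing.isLinear.Build K {freeg T / K} superext _ superext_pi
    superext_pi_is_linear.

Definition wedge (x : T) : superext := superext_pi (free_tuple x).

Inductive homog_wedge (e : bool) : superext -> Prop :=
| HomogWedge d x : homog_at gr d x -> total d = e -> homog_wedge e (wedge x).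

Definition superext_gr (e : bool) : superext -> Prop := lspan (homog_wedge e).

Lemma wedge_multilinear : multilinear wedge.
Proof.
move=> x i a u v; rewrite /wedge -superext_pi_is_linear.
apply/superext_pi_eq/superext_relP; rewrite -[X in lspan _ X]addr0 -[X in X + 0]scale1r.
by do 2!constructor.
Qed.

Lemma wedge_super_skew : super_skew gr wedge.
Proof.
move=> d x i j hx ij; rewrite /wedge -linearZ.
apply/superext_pi_eq/superext_relP; rewrite -[X in lspan _ X]addr0 -[X in X + 0]scale1r.
by do 2!constructor.
Qed.

Lemma free_tuple_ind (P : {freeg T / K} -> Prop) :
  P 0 -> (forall a x v, P v -> P (a *: free_tuple x + v)) -> forall u, P u.
Proof.
move=> P0 PS u; rewrite -[u]freeg_sumE; elim: (dom u) => [|x s IH].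
  by rewrite big_nil.
have -> : \sum_(z <- x :: s) [freeg [:: (coeff z u, z)]] =
    coeff x u *: free_tuple x + \sum_(z <- s) [freeg [:: (coeff z u, z)]].
  rewrite big_cons; congr (_ + _); apply/eqP/freeg_eqP => y.
  by rewrite coeffZ !coeffU mul1r.
exact: PS.
Qed.

Lemma superext_universal (V : lmodType K) (f : T -> V) :
  multilinear f -> super_skew gr f ->
  exists! g : superext -> V, linear g /\ forall x, g (wedge x) = f x.
Proof.
move=> fM fS.
have FD u v : fglift f (u - v) = fglift f u - fglift f v.
  exact: lift_is_additive.
have F0 : fglift f 0 = 0 by rewrite -(subrr 0) FD subrr.
have FN u : fglift f (- u) = - fglift f u by rewrite -[- u]add0r FD F0 add0r.
have FA u v : fglift f (u + v) = fglift f u + fglift f v.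
  by rewrite -[v in LHS]opprK FD FN opprK.
have FU a x : fglift f (a *: free_tuple x) = a *: f x.
  have -> : a *: free_tuple x = [freeg [:: (a, x)]].
    by apply/eqP/freeg_eqP => y; rewrite coeffZ !coeffU mul1r.
  by rewrite liftU.
have FZ a u : fglift f (a *: u) = a *: fglift f u.
  elim/free_tuple_ind: u => [|b x v IH]; first by rewrite scaler0 F0 scaler0.
  by rewrite scalerDr !FA IH scalerA !FU scalerDr scalerA.
have F1 x : fglift f (free_tuple x) = f x by rewrite liftU scale1r.
have FR u : u \in superext_rel -> fglift f u = 0.
  move/superext_relP; elim=> [//|a g w Hg _ IH].
  rewrite FA FZ IH addr0; case: Hg => [x i b u1 u2|d x i j hx ij].
    by rewrite FD FA FZ !F1 fM subrr scaler0.
  by rewrite FD FZ !F1 (fS _ _ _ _ hx ij) subrr scaler0.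
pose g (w : superext) : V := fglift f (repr (w : Quotient.quot superext_rel)).
have gpi u : g (superext_pi u) = fglift f u.
  apply/eqP; rewrite -subr_eq0 -FD; apply/eqP/FR.
  by rewrite Quotient.idealrBE reprK.
exists g; split; first split.
- move=> a v w; case: (superext_pi_surj v) => s <-.
  case: (superext_pi_surj w) => t <-.
  by rewrite -superext_pi_is_linear !gpi FA FZ.
- by move=> x; rewrite /wedge gpi.
move=> h [hl hw]; apply/funext => w; case: (superext_pi_surj w) => u <-.
elim/free_tuple_ind: u => [|a x v IH].
  rewrite gpi F0 linear0; have := hl (-1) 0 0.
  by rewrite scaler0 addr0 scaleN1r addNr => ->.
by rewrite gpi FA FU superext_pi_is_linear hl -/(wedge x) hw -IH gpi.
Qed.

End SuperExteriorPower.

Arguments superext_gr {K N} gr p e _.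

Section HomAlgebras.
Variables (K : fieldType) (N : lmodType K) (gr : bool -> N -> Prop).

(* The arguments of the i-th term of the twisted action of x on y:
   alpha y_1, ..., [x_1, ..., x_m, y_i], ..., alpha y_p *)
Definition act_at m p (bra : {ffun 'I_m.+1 -> N} -> N) (al : N -> N)
    (x : {ffun 'I_m -> N}) (y : {ffun 'I_p -> N}) (i : 'I_p)
    : {ffun 'I_p -> N} :=
  [ffun k => if k == i then bra (ffrcons x (y i)) else al (y k)].

(* The arity is n = m.+1, so that n - 1 = m. *)
Record hom_nambu_lie_superalgebra m
    (bra : {ffun 'I_m.+1 -> N} -> N) (al : {linear N -> N}) : Prop := {
  hnl_grading : is_grading gr;
  hnl_multilinear : multilinear bra;
  hnl_bra_even : forall d x, homog_at gr d x -> gr (total d) (bra x);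
  hnl_al_even : even_map gr gr al;
  hnl_identity : forall (d : 'I_m -> bool) (e : 'I_m.+1 -> bool) x y,
    homog_at gr d x -> homog_at gr e y ->
    bra (ffrcons [ffun k => al (x k)] (bra y)) =
      \sum_(i < m.+1) (-1) ^+ (total d && total_lt e i)
                        *: bra (act_at bra al x y i);
  hnl_super_skew : super_skew gr bra;
  hnl_multiplicative : forall x, al (bra x) = bra [ffun k => al (x k)] }.

Record hom_leibniz_superalgebra
    (br : {bilinear N -> N -> N}) (al : {linear N -> N}) : Prop := {
  hl_grading : is_grading gr;
  hl_br_even : forall d e x y, gr d x -> gr e y -> gr (d (+) e) (br x y);
  hl_al_even : even_map gr gr al;
  hl_identity : forall d e f x y z, gr d x -> gr e y -> gr f z ->
    br (br x y) (al z) =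
      br (al x) (br y z) - (-1) ^+ (d && e) *: br (al y) (br x z) }.

Definition is_induced_twist m (al : N -> N)
    (alt : superext gr m -> superext gr m) :=
  forall x, alt (wedge gr x) = wedge gr [ffun k => al (x k)].

Definition is_induced_bracket m (bra : {ffun 'I_m.+1 -> N} -> N) (al : N -> N)
    (br : superext gr m -> superext gr m -> superext gr m) :=
  forall d e x y, homog_at gr d x -> homog_at gr e y ->
    br (wedge gr x) (wedge gr y) =
      \sum_(i < m) (-1) ^+ (total d && total_lt e i)
                     *: wedge gr (act_at bra al x y i).

End HomAlgebras.

(* Main.v *)
Require Import Defs.
From HB Require Import structures.
From mathcomp Require Import all_boot all_algebra sesquilinear.
From mathcomp Require Import all_fingroup boolp.

Set Implicit Arguments.
Unset Strict Implicit.
Unset Printing Implicit Defensive.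

(* [total] is the degree of a tuple, not totality of a relation, and [lift] is
   the map on ordinals, not the extension of a map to a free module. *)
Import Defs fintype.
Import GRing.Theory.
Local Open Scope ring_scope.

(** For [x] in N^(n-1) write ad_x v = [x_1, ..., x_(n-1), v]. The bracket
    [x, y] lets ad_x act on y_1 /\ ... /\ y_(n-1) as a super-derivation twisted
    by alpha, and the statement has two parts.

    Existence. A linear map on the exterior power is determined by its values on
    wedges of homogeneous vectors, and any family of multilinear maps indexed by
    the degrees of the arguments defines one as soon as it is super-skew on
    homogeneous tuples ([superext_lift_homog]): expand each argument into its
    homogeneous components and use the universal property. This is applied
    twice, in x and then in y. Skewness in x is that of the n-ary bracket.
    Skewness in y holds because exchanging y_i and y_j permutes the summands, and
    the sign for carrying ad_x to its slot changes exactly as the Koszul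
    sign of the exchange does ([shift_swap_sign]).

    Hom-Leibniz identity. By linearity it is enough to treat wedges x, y, z of
    homogeneous vectors. In [alpha x, [y, z]] the operators hit two slots of z.
    When the slots i and j differ, multiplicativity gives
    alpha (ad_y z_j) = ad_(alpha y) (alpha z_j), so the term is symmetric under
    exchanging (x, i) and (y, j), up to the sign (-1)^(|x||y|); hence all these
    terms cancel in [alpha x, [y, z]] - (-1)^(|x||y|) [alpha y, [x, z]]. The
    terms with i = j contain the twisted supercommutator of ad_x and ad_y applied
    to z_i, which the super-Hom-Nambu identity turns into the sum of the
    operators attached to the terms of [x, y] ([ad_commutator]). That is
    [[x, y], alpha z].

    The grading of the exterior power is direct because the projection onto its
    odd part is again given by [superext_lift_homog]. *)

(** * Degrees and Koszul signs *)

Section Degrees.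
Variables (p : nat).
Implicit Types (d : 'I_p -> bool) (i j k : 'I_p) (s : bool).

(** The degrees of a tuple whose [i]-th entry has been hit by an operator of
    parity [s]. *)
Definition shift_deg d i s : 'I_p -> bool :=
  fun k => if k == i then s (+) d k else d k.

Lemma sum_shift_deg (P : pred 'I_p) d i s :
  \big[addb/false]_(k | P k) shift_deg d i s k =
    \big[addb/false]_(k | P k) d k (+) (P i && s).
Proof.
rewrite !(big_mkcond P) (bigD1 i) // [in RHS](bigD1 i) //= /shift_deg eqxx.
rewrite (eq_bigr (fun k => if P k then d k else false)) => [|k /negPf-> //].
by case: (P i) s (d i) (\big[_/_]_(_ | _) _) => [] [] [] [].
Qed.

Lemma sum_deg_tperm (P : pred 'I_p) d i j : i != j ->
  \big[addb/false]_(k | P k) d (tperm i j k) =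
    \big[addb/false]_(k | P k) d k (+) ((P i (+) P j) && (d i (+) d j)).
Proof.
move=> ij; have ji : j != i by rewrite eq_sym.
rewrite !(big_mkcond P) (bigD1 i) // (bigD1 j) //= [in RHS](bigD1 i) //=.
rewrite [in RHS](bigD1 j) //= tpermL tpermR.
rewrite (eq_bigr (fun k => if P k then d k else false)) => [|k /andP[ki kj]].
  by case: (P i) (P j) (d i) (d j) (\big[_/_]_(_ | _) _) => [] [] [] [] [].
by rewrite tpermD // eq_sym.
Qed.

Lemma total_shift_deg d i s : total (shift_deg d i s) = s (+) total d.
Proof. by rewrite /total sum_shift_deg addbC. Qed.

Lemma total_lt_shift_deg d i s k :
  total_lt (shift_deg d i s) k = total_lt d k (+) ((i < k)%N && s).
Proof. exact: sum_shift_deg. Qed.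

Lemma total_tperm d i j : total (fun k => d (tperm i j k)) = total d.
Proof. by rewrite /total [RHS](reindex_inj (@perm_inj _ (tperm i j))). Qed.

Lemma total_lt_split d i j : (i < j)%N ->
  total_lt d j = total_lt d i (+) d i (+) total_between d i j.
Proof.
move=> ij; rewrite /total_lt (bigD1 i) //= (bigID (fun k : 'I_p => k < i)%N) /=.
rewrite addbA [d i (+) _]addbC; congr (_ (+) _ (+) _); apply: eq_bigl => k.
  case: (ltngtP k i) => [ki|ki|/val_inj->]; rewrite ?ltnn ?andbF //;
  by rewrite -val_eqE neq_ltn ki ?(ltn_trans ki ij) ?andbF.
by rewrite -val_eqE; case: (ltngtP k i) => ki; rewrite ?andbT ?andbF.
Qed.

(** The exponent in [swap_sign], up to the overall skew sign. *)
Definition swap_exp d i j : bool :=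
  (d i && d j) (+) ((d i (+) d j) && total_between d i j).

(** Replacing the [k]-th entry by its image under an operator of parity [s]
    costs the sign of moving the operator past the preceding entries. This is
    the compatibility of that sign with the exchange of the entries [i] and [j],
    and the reason why a derivation descends to the exterior power. *)
Lemma shift_swap_sign d i j k s : (i < j)%N ->
  (s && total_lt (fun l => d (tperm i j l)) (tperm i j k))
    (+) swap_exp (shift_deg d k s) i j =
  swap_exp d i j (+) (s && total_lt d k).
Proof.
move=> ij; have nij : i != j by rewrite -val_eqE neq_ltn ij.
rewrite /total_lt sum_deg_tperm // -!/(total_lt _ _) /swap_exp.
rewrite [total_between (shift_deg _ _ _) _ _]sum_shift_deg -/(total_between _ _ _).
(* The exchange moves [k] across [j], across [i], or leaves it in place; in the
   last case the sign changes only if [k] lies between [i] and [j]. *)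
case: tpermP => [->|->|/eqP ki /eqP kj].
- rewrite /shift_deg eqxx eq_sym (negPf nij) ij !ltnn /= (total_lt_split _ ij).
  by case: s (d i) (d j) (total_lt d i) (total_between _ _ _) => [] [] [] [] [].
- rewrite /shift_deg eqxx (negPf nij) !ltnn (ltnNge j i) (ltnW ij) /= ?andbF ?addbF.
  rewrite (total_lt_split _ ij).
  by case: s (d i) (d j) (total_lt d i) (total_between _ _ _) => [] [] [] [] [].
have -> : ((i < k) (+) (j < k) = (i < k < j))%N.
  move: kj; rewrite -val_eqE.
  case: (ltngtP j k) => //= jk _; last by rewrite addbF andbT.
  by rewrite (ltn_trans ij jk).
rewrite /shift_deg eq_sym (negPf ki) eq_sym (negPf kj).
case: (i < k < j)%N; last by rewrite /= !addbF addbC.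
by case: s (d i) (d j) (total_lt d k) (total_between _ _ _) => [] [] [] [] [].
Qed.

End Degrees.

(** * Tuples and multilinear maps *)

Section Tuples.
Variables (K : fieldType) (N : lmodType K) (gr : bool -> N -> Prop).

Lemma swap_signE p (d : 'I_p -> bool) i j :
  swap_sign K d i j = - (-1) ^+ swap_exp d i j.
Proof. by rewrite /swap_sign mulNr -signr_addb. Qed.

Lemma upd_eq p (x : {ffun 'I_p -> N}) i v : upd x i v i = v.
Proof. by rewrite ffunE eqxx. Qed.

Lemma upd_id p (x : {ffun 'I_p -> N}) i v : x i = v -> upd x i v = x.
Proof. by move=> <-; apply/ffunP=> k; rewrite ffunE; case: eqP => // ->. Qed.

Lemma upd_upd p (x : {ffun 'I_p -> N}) i u v : upd (upd x i u) i v = upd x i v.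
Proof. by apply/ffunP=> k; rewrite !ffunE; case: eqP. Qed.

Lemma updC p (x : {ffun 'I_p -> N}) i j u v : i != j ->
  upd (upd x i u) j v = upd (upd x j v) i u.
Proof.
by move=> ij; apply/ffunP=> k; rewrite !ffunE; case: (eqVneq k i) => // ->;
  rewrite (negPf ij).
Qed.

Section Multilinear.
Variables (p : nat) (V : lmodType K).
Implicit Types (f : {ffun 'I_p -> N} -> V) (x : {ffun 'I_p -> N}).

Lemma multilinear0 f x i : multilinear f -> x i = 0 -> f x = 0.
Proof.
move=> fM xi; have := fM x i (-1) 0 0.
by rewrite scaler0 addr0 scaleN1r addNr upd_id.
Qed.

Lemma multilinear_sum f x i (I : finType) (c : I -> K) (v : I -> N) :
  multilinear f ->
  f (upd x i (\sum_k c k *: v k)) = \sum_k c k *: f (upd x i (v k)).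
Proof.
move=> fM; elim/big_rec2: _ => [|k u w _ <-].
  by rewrite (multilinear0 (i := i)) ?upd_eq.
by rewrite fM.
Qed.

Lemma multilinear_comb (I : finType) (c : I -> K)
    (f : I -> {ffun 'I_p -> N} -> V) :
  (forall k, multilinear (f k)) -> multilinear (fun x => \sum_k c k *: f k x).
Proof.
move=> fM x i a u v; rewrite scaler_sumr -big_split /=; apply: eq_bigr => k _.
by rewrite fM scalerDr !scalerA mulrC.
Qed.

End Multilinear.

Lemma homog_at_upd p (d : 'I_p -> bool) (x : {ffun 'I_p -> N}) i s v :
  homog_at gr d x -> gr (s (+) d i) v -> homog_at gr (shift_deg d i s) (upd x i v).
Proof.
by move=> hx hv k; rewrite /shift_deg ffunE; case: eqP => [->|].
Qed.

Lemma homog_at_swap p (d : 'I_p -> bool) (x : {ffun 'I_p -> N}) i j :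
  homog_at gr d x -> homog_at gr (fun k => d (tperm i j k)) (swap x i j).
Proof. by move=> hx k; rewrite ffunE. Qed.

Lemma ffrcons_max p (x : {ffun 'I_p -> N}) (v : N) : ffrcons x v (@ord_max p) = v.
Proof. by rewrite ffunE unlift_none. Qed.

Lemma ffrcons_lift p (x : {ffun 'I_p -> N}) v i : ffrcons x v (lift ord_max i) = x i.
Proof. by rewrite ffunE liftK. Qed.

Lemma ffrconsP p (x y : {ffun 'I_p.+1 -> N}) :
  x ord_max = y ord_max -> (forall i, x (lift ord_max i) = y (lift ord_max i)) ->
  x = y.
Proof. by move=> h0 h; apply/ffunP=> k; case: (unliftP ord_max k) => [i|] ->. Qed.

Lemma upd_ffrcons_max p (x : {ffun 'I_p -> N}) u v :
  upd (ffrcons x u) ord_max v = ffrcons x v.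
Proof.
apply: ffrconsP => [|i]; first by rewrite upd_eq ffrcons_max.
by rewrite ffunE eq_sym (negPf (neq_lift _ _)) !ffrcons_lift.
Qed.

Lemma upd_ffrcons_lift p (x : {ffun 'I_p -> N}) i u v :
  upd (ffrcons x v) (lift ord_max i) u = ffrcons (upd x i u) v.
Proof.
apply: ffrconsP => [|k]; first by rewrite ffunE (negPf (neq_lift _ _)) !ffrcons_max.
by rewrite ffunE (inj_eq lift_inj) !ffrcons_lift ffunE.
Qed.

Lemma swap_ffrcons p (x : {ffun 'I_p -> N}) i j v :
  swap (ffrcons x v) (lift ord_max i) (lift ord_max j) = ffrcons (swap x i j) v.
Proof.
apply: ffrconsP => [|k].
  by rewrite ffunE tpermD ?ffrcons_max // eq_sym (neq_lift ord_max).
rewrite ffrcons_lift [LHS]ffunE [RHS]ffunE.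
case: (tpermP i j k) => [->|->|/eqP ki /eqP kj];
  rewrite ?tpermL ?tpermR ?ffrcons_lift //.
by rewrite tpermD ?ffrcons_lift // (inj_eq lift_inj) eq_sym.
Qed.

Definition deg_rcons p (d : 'I_p -> bool) (s : bool) : 'I_p.+1 -> bool :=
  fun k => if unlift ord_max k is Some l then d l else s.

Lemma deg_rcons_lift p (d : 'I_p -> bool) s i : deg_rcons d s (lift ord_max i) = d i.
Proof. by rewrite /deg_rcons liftK. Qed.

Lemma deg_rcons_max p (d : 'I_p -> bool) s : deg_rcons d s ord_max = s.
Proof. by rewrite /deg_rcons unlift_none. Qed.

Lemma homog_at_ffrcons p (d : 'I_p -> bool) (x : {ffun 'I_p -> N}) s v :
  homog_at gr d x -> gr s v -> homog_at gr (deg_rcons d s) (ffrcons x v).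
Proof. by move=> hx hv k; rewrite /deg_rcons ffunE; case: unliftP. Qed.

Lemma sum_deg_lift p (P : pred 'I_p.+1) (F : 'I_p.+1 -> bool) :
  \big[addb/false]_(k | P k) F k =
    \big[addb/false]_(k | P (lift ord_max k)) F (lift ord_max k)
      (+) (P ord_max && F ord_max).
Proof.
rewrite big_mkcond big_ord_recr; congr (_ (+) _).
rewrite [RHS]big_mkcond; apply: eq_bigr => k _.
by have -> : widen_ord (leqnSn p) k = lift ord_max k by apply: val_inj; exact/esym/lift_max.
Qed.

Lemma total_lt_rcons_lift p (d : 'I_p -> bool) s i :
  total_lt (deg_rcons d s) (lift ord_max i) = total_lt d i.
Proof.
rewrite /total_lt sum_deg_lift lift_max [(ord_max < i)%N]ltnNge (ltnW (ltn_ord i)) addbF.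
by apply: eq_big => [k|k _]; rewrite ?lift_max ?deg_rcons_lift.
Qed.

Lemma total_lt_rcons_max p (d : 'I_p -> bool) s :
  total_lt (deg_rcons d s) ord_max = total d.
Proof.
rewrite /total_lt sum_deg_lift ltnn addbF.
by apply: eq_big => [k|k _]; rewrite ?lift_max ?deg_rcons_lift //=; exact: ltn_ord.
Qed.

Lemma total_rcons p (d : 'I_p -> bool) s : total (deg_rcons d s) = total d (+) s.
Proof.
rewrite /total sum_deg_lift deg_rcons_max; congr (_ (+) _).
by apply: eq_bigr => k _; rewrite deg_rcons_lift.
Qed.

Lemma swap_sign_rcons p (d : 'I_p -> bool) s i j :
  swap_sign K (deg_rcons d s) (lift ord_max i) (lift ord_max j) = swap_sign K d i j.
Proof.
rewrite /swap_sign !deg_rcons_lift; congr (_ * (-1) ^+ (_ && _)).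
rewrite /total_between sum_deg_lift !lift_max [(ord_max < j)%N]ltnNge (ltnW (ltn_ord j)) andbF addbF.
by apply: eq_big => [k|k _]; rewrite ?lift_max ?deg_rcons_lift.
Qed.

End Tuples.

(** * Linear maps on the super exterior power *)

Section Span.
Variables (K : fieldType) (V : lmodType K) (S : V -> Prop).

Lemma lspan_subspace : subspace_prop (lspan S).
Proof.
split=> [|a u v Hu Hv]; first exact: lspan_zero.
elim: Hu => [|b g w Hg _ IH]; first by rewrite scaler0 add0r.
by rewrite scalerDr scalerA -addrA; constructor.
Qed.

Lemma lspan_gen u : S u -> lspan S u.
Proof.
by move=> Su; rewrite -[u]addr0 -[u]scale1r; constructor=> //; constructor.
Qed.

Lemma lspan_sum (I : finType) (c : I -> K) (v : I -> V) :
  (forall k, S (v k)) -> lspan S (\sum_k c k *: v k).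
Proof. by move=> Sv; elim/big_rec: _ => [|k u _ Hu]; constructor. Qed.

End Span.

Section GradedProjection.
Variables (K : fieldType) (N : lmodType K) (gr : bool -> N -> Prop).
Hypothesis grN : is_grading gr.

Lemma grading0 e : gr e 0.
Proof. by case: grN => /(_ e) []. Qed.

Lemma graded_uniq a b a' b' : gr false a -> gr true b -> gr false a' ->
  gr true b' -> a + b = a' + b' -> a = a' /\ b = b'.
Proof.
case: grN => sub _ gr0 ha hb ha' hb' E.
have E' : a - a' = b' - b.
  by apply/eqP; rewrite subr_eq addrAC [b' + a']addrC -E addrK.
have ga : gr false (a - a').
  by rewrite addrC -scaleN1r; case: (sub false) => _; apply.
have gb : gr true (a - a').
  by rewrite E' addrC -scaleN1r; case: (sub true) => _; apply.
have a0 := gr0 _ ga gb; have b0 : b' - b = 0 by rewrite -E'.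
by split; [apply: subr0_eq | apply/esym/subr0_eq].
Qed.

Lemma graded_projection : exists pr : bool -> N -> N,
  [/\ forall e v, gr e (pr e v), forall v, v = pr false v + pr true v,
      forall e, linear (pr e)
    & forall e e' v, gr e v -> pr e' v = if e' == e then v else 0].
Proof.
have [sub dec _] := grN.
have /choice[f fP] v : exists ab : N * N,
    [/\ gr false ab.1, gr true ab.2 & v = ab.1 + ab.2].
  by have [a [b H]] := dec v; exists (a, b).
exists (fun e v => if e then (f v).2 else (f v).1); split.
- by move=> e v; have [] := fP v; case: e.
- by move=> v; have [] := fP v.
- have H a u v : (f (a *: u + v)).1 = a *: (f u).1 + (f v).1 /\
      (f (a *: u + v)).2 = a *: (f u).2 + (f v).2.
    have [h1 h2 E] := fP (a *: u + v).
    have [u1 u2 Eu] := fP u; have [v1 v2 Ev] := fP v.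
    apply: graded_uniq => //; try by apply: (sub _).2.
    by rewrite -E {1}Eu {1}Ev scalerDr addrACA.
  by case=> a u v; case: (H a u v).
- move=> e e' v hv; have [h1 h2 E] := fP v.
  case: e hv => hv.
    have [<- <-] : 0 = (f v).1 /\ v = (f v).2.
      by apply: graded_uniq => //; [exact: grading0|rewrite add0r].
    by case: e'.
  have [<- <-] : v = (f v).1 /\ 0 = (f v).2.
    by apply: graded_uniq => //; [exact: grading0|rewrite addr0].
  by case: e'.
Qed.

End GradedProjection.

Section Extension.
Variables (K : fieldType) (N : lmodType K) (gr : bool -> N -> Prop) (p : nat).
Hypothesis grN : is_grading gr.
Implicit Types (d : 'I_p -> bool) (x : {ffun 'I_p -> N}).

(** Such a [G] need not be one single super-skew map: the sign rule relates
    different members of the family, and only on homogeneous tuples. Summing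
    [G d] over the components of degrees [d] of the arguments gives a genuine
    multilinear super-skew map, since all components but one of a homogeneous
    tuple have a zero entry. *)
Lemma superext_lift_homog (V : lmodType K)
    (G : ('I_p -> bool) -> {ffun 'I_p -> N} -> V) :
  (forall d, multilinear (G d)) ->
  (forall d x (i j : 'I_p), homog_at gr d x -> (i < j)%N ->
     G (fun k => d (tperm i j k)) (swap x i j) = swap_sign K d i j *: G d x) ->
  exists g : superext gr p -> V,
    linear g /\ forall d x, homog_at gr d x -> g (wedge gr x) = G d x.
Proof.
move=> GM GS; have [pr [pr_gr _ pr_lin pr_id]] := graded_projection grN.
pose comp (d : 'I_p -> bool) x : {ffun 'I_p -> N} := [ffun i => pr (d i) (x i)].
pose F x := \sum_(d : {ffun 'I_p -> bool}) (1 : K) *: G d (comp d x).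
have comp_upd d x i v : comp d (upd x i v) = upd (comp d x) i (pr (d i) v).
  by apply/ffunP=> k; rewrite !ffunE; case: eqP => // ->.
have FG d x : homog_at gr d x -> F x = G d x.
  move=> hx; have Ed : d = finfun d :> ('I_p -> bool).
    by apply: funext => i; rewrite ffunE.
  rewrite /F (bigD1 (finfun d)) //= big1 => [|e ne]; rewrite -?Ed.
    rewrite addr0 scale1r; congr (G d _); apply/ffunP=> i.
    by rewrite ffunE (pr_id _ _ _ (hx i)) eqxx.
  have [i ei] : exists i, e i != d i.
    apply/existsP; rewrite -negb_forall; apply: contra ne => /forallP ed.
    by apply/eqP/ffunP=> i; rewrite ffunE; exact/eqP.
  rewrite (multilinear0 (i := i) (GM e)) ?scaler0 //.
  by rewrite ffunE (pr_id _ _ _ (hx i)) (negPf ei).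
have FM : multilinear F.
  apply: multilinear_comb => d x i a u v.
  by rewrite !comp_upd (pr_lin _ a u v) GM.
have FS : super_skew gr F.
  move=> d x i j hx ij; rewrite (FG _ _ hx) -GS // -FG //.
  exact: homog_at_swap.
have [g [[gl gw] _]] := superext_universal FM FS.
by exists g; split=> // d x hx; rewrite gw; exact: FG.
Qed.

Definition homog_gen (w : superext gr p) : Prop :=
  exists d x, homog_at gr d x /\ w = wedge gr x.

(** Make the entries homogeneous one at a time, from the last one: splitting the
    entry [k] leaves the entries from [k] on homogeneous. *)
Lemma superext_homog_span w : lspan homog_gen w.
Proof.
have [sub dec _] := grN.
have [L0 LS] := lspan_subspace homog_gen.
have H k : (k <= p)%N -> forall x,
    (forall i : 'I_p, (k <= i)%N -> exists e, gr e (x i)) ->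
    lspan homog_gen (wedge gr x).
  elim: k => [_|k IH kp] x hx.
    have /choice[d hd] i := hx i isT.
    by apply: lspan_gen; exists d, x.
  pose i := Ordinal kp; have [a [b [ha hb E]]] := dec (x i).
  rewrite -(@upd_id _ _ _ x i (1 *: a + b)); last by rewrite scale1r.
  rewrite wedge_multilinear; apply: LS; apply: IH (ltnW kp) _ _ => j kj.
    rewrite ffunE; case: eqP => [_|ji]; first by exists false.
    apply: hx; rewrite ltn_neqAle kj andbT; apply/eqP => E'.
    by apply: ji; apply: val_inj.
  rewrite ffunE; case: eqP => [_|ji]; first by exists true.
  apply: hx; rewrite ltn_neqAle kj andbT; apply/eqP => E'.
  by apply: ji; apply: val_inj.
have [u <-] := superext_pi_surj w.
elim/free_tuple_ind: u => [|a x v IH]; first by rewrite linear0.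
rewrite superext_pi_is_linear; apply: LS => //; apply: (H p) => // i.
by rewrite leqNgt ltn_ord.
Qed.

Lemma linear_eq_homog (V : lmodType K) (f g : superext gr p -> V) :
  linear f -> linear g ->
  (forall d x, homog_at gr d x -> f (wedge gr x) = g (wedge gr x)) -> f =1 g.
Proof.
move=> fl gl fg w.
have z0 (h : superext gr p -> V) : linear h -> h 0 = 0.
  by move=> hl; have := hl (-1) 0 0; rewrite scaler0 addr0 scaleN1r addNr.
elim: {w}(superext_homog_span w) => [|a u v [d [x [hx ->]]] _ IH].
  by rewrite !z0.
by rewrite fl gl IH (fg _ _ hx).
Qed.

Lemma superext_is_grading : is_grading (superext_gr gr p).
Proof.
have sub e : subspace_prop (superext_gr gr p e) by exact: lspan_subspace.
split=> // [v|v v0 v1].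
  elim: {v}(superext_homog_span v)
    => [|a u v [d [x [hx ->]]] _ [v0 [v1 [h0 h1 ->]]]].
    by exists 0, 0; rewrite addr0; split=> //; exact: (sub _).1.
  have hw : superext_gr gr p (total d) (wedge gr x).
    by apply: lspan_gen; exists d.
  case: (total d) hw => hw.
    exists v0, (a *: wedge gr x + v1); split=> //; first exact: (sub _).2.
    by rewrite addrCA.
  exists (a *: wedge gr x + v0), v1; split=> //; first exact: (sub _).2.
  by rewrite addrA.
(* [g] is the projection onto the odd part: it fixes odd elements and kills even
   ones, so an element of both parts is zero. *)
have [|d x i j hx ij|g [gl gw]] := @superext_lift_homog (superext gr p)
    (fun d x => (total d)%:R *: wedge gr x).
- move=> d x i a u w; rewrite wedge_multilinear scalerDr !scalerA.
  by rewrite [a * _]mulrC.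
- by rewrite total_tperm (wedge_super_skew hx ij) !scalerA mulrC.
have gE e w : superext_gr gr p e w -> g w = e%:R *: w.
  elim=> [|a u w' [d x hx <-] _ IH].
    by have := gl (-1) 0 0; rewrite !scaler0 addr0 scaleN1r addNr.
  by rewrite gl (gw _ _ hx) IH scalerDr !scalerA mulrC.
by rewrite -[v]scale1r -(gE true) // (gE false) // scale0r.
Qed.

End Extension.

(** * The bracket on fundamental objects *)

Section Bracket.
Variables (K : fieldType) (N : lmodType K) (gr : bool -> N -> Prop) (m : nat).
Variables (bra : {ffun 'I_m.+1 -> N} -> N) (al : {linear N -> N}).
Hypothesis HN : hom_nambu_lie_superalgebra gr bra al.
Implicit Types (d e f : 'I_m -> bool) (x y z : {ffun 'I_m -> N}).

Let grN := hnl_grading HN.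
Let braM := hnl_multilinear HN.

Local Notation W := (superext gr m).
Local Notation w := (wedge gr).

Definition ad x v := bra (ffrcons x v).
Definition twist x : {ffun 'I_m -> N} := [ffun k => al (x k)].

Lemma act_atE x y i : act_at bra al x y i = upd (twist y) i (ad x (y i)).
Proof. by apply/ffunP=> k; rewrite !ffunE. Qed.

Lemma ad_linear x : linear (ad x).
Proof.
move=> a u v; rewrite /ad -(upd_ffrcons_max x 0 (_ + _)) braM.
by rewrite !upd_ffrcons_max.
Qed.

Lemma ad_multilinear v : multilinear (ad^~ v).
Proof. by move=> x i a u u'; rewrite /ad -!upd_ffrcons_lift braM. Qed.

Lemma ad_homog d s x v : homog_at gr d x -> gr s v -> gr (total d (+) s) (ad x v).
Proof.
move=> hx hv; rewrite -total_rcons.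
by apply: hnl_bra_even HN _ _ _; exact: homog_at_ffrcons.
Qed.

(** Super-skewness of the n-ary bracket is only about homogeneous arguments, but
    the last argument is not moved and does not enter the sign, so it can be
    arbitrary by linearity. *)
Lemma ad_skew d x (i j : 'I_m) v : homog_at gr d x -> (i < j)%N ->
  ad (swap x i j) v = swap_sign K d i j *: ad x v.
Proof.
move=> hx ij; have [_ dec _] := grN; have [v0 [v1 [h0 h1 ->]]] := dec v.
have H s u : gr s u -> ad (swap x i j) u = swap_sign K d i j *: ad x u.
  move=> hu; rewrite /ad -swap_ffrcons -(swap_sign_rcons K d s).
  apply: hnl_super_skew HN _ _ _ _ (homog_at_ffrcons hx hu) _.
  by rewrite !lift_max.
have E z : ad z (v0 + v1) = ad z v0 + ad z v1.
  by rewrite -[v0]scale1r ad_linear !scale1r.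
by rewrite !E scalerDr (H false) // (H true).
Qed.

Lemma ad_twist x v : al (ad x v) = ad (twist x) (al v).
Proof.
rewrite /ad (hnl_multiplicative HN); congr bra.
by apply: ffrconsP => [|i]; rewrite ffunE ?ffrcons_max ?ffrcons_lift // ffunE.
Qed.

(** The super-Hom-Nambu identity with y_1, ..., y_(n-1), v as inner arguments,
    the summand where [x] acts on [v] being moved to the other side. *)
Lemma ad_commutator d e s x y v :
  homog_at gr d x -> homog_at gr e y -> gr s v ->
  \sum_(i < m) (-1) ^+ (total d && total_lt e i)
                 *: ad (act_at bra al x y i) (al v) =
    ad (twist x) (ad y v)
      - (-1) ^+ (total d && total e) *: ad (twist y) (ad x v).
Proof.
move=> hx hy hv; apply/esym/eqP; rewrite subr_eq; apply/eqP.
rewrite {1}/ad (hnl_identity HN hx (homog_at_ffrcons hy hv)) big_ord_recr /=.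
have Ei i : widen_ord (leqnSn m) i = lift ord_max i.
  by apply: val_inj; exact/esym/lift_max.
congr (_ + _); last first.
  rewrite total_lt_rcons_max /ad; congr (_ *: bra _).
  by apply: ffrconsP => [|i]; rewrite ffunE ?eqxx ?ffrcons_max // eq_sym
    (negPf (neq_lift _ _)) !ffrcons_lift ffunE.
apply: eq_bigr => i _; rewrite Ei total_lt_rcons_lift /ad; congr (_ *: bra _).
apply: ffrconsP => [|k].
  by rewrite ffunE (negPf (neq_lift _ _)) !ffrcons_max.
by rewrite ffunE (inj_eq lift_inj) !ffrcons_lift ffunE.
Qed.

Lemma twist_homog d x : homog_at gr d x -> homog_at gr d (twist x).
Proof. by move=> hx i; rewrite ffunE; exact: (hnl_al_even HN). Qed.

Lemma act_at_homog d e x y i : homog_at gr d x -> homog_at gr e y ->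
  homog_at gr (shift_deg e i (total d)) (act_at bra al x y i).
Proof.
move=> hx hy; rewrite act_atE; apply: homog_at_upd; first exact: twist_homog.
exact: ad_homog.
Qed.

Lemma twist_upd x i v : twist (upd x i v) = upd (twist x) i (al v).
Proof. by apply/ffunP=> k; rewrite !ffunE; case: eqP. Qed.

Lemma twist_swap x i j : twist (swap x i j) = swap (twist x) i j.
Proof. by apply/ffunP=> k; rewrite !ffunE. Qed.

Lemma act_at_multilinear x k : multilinear (fun y => w (act_at bra al x y k)).
Proof.
move=> y i a u v; rewrite !act_atE !twist_upd.
case: (eqVneq k i) => [->|ki]; last first.
  rewrite !ffunE (negPf ki) !(updC _ _ _ (_ : i != k)) 1?eq_sym //.
  by rewrite linearP wedge_multilinear.
by rewrite !upd_upd !upd_eq ad_linear wedge_multilinear.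
Qed.

Lemma act_at_multilinear_l y k : multilinear (fun x => w (act_at bra al x y k)).
Proof. by move=> x i a u v; rewrite !act_atE ad_multilinear wedge_multilinear. Qed.

(** The right-hand side of the defining formula, with formal degrees [d] and [e]
    and arbitrary entries: this keeps it multilinear in each tuple, as
    [superext_lift_homog] requires. *)
Definition bracket d e x y : W :=
  \sum_(i < m) (-1) ^+ (total d && total_lt e i) *: w (act_at bra al x y i).

Lemma bracket_multilinear_l d e y : multilinear (fun x => bracket d e x y).
Proof. by apply: multilinear_comb => k; exact: act_at_multilinear_l. Qed.

Lemma bracket_multilinear_r d e x : multilinear (bracket d e x).
Proof. by apply: multilinear_comb => k; exact: act_at_multilinear. Qed.

Lemma bracket_skew_l d e x y (i j : 'I_m) : homog_at gr d x -> (i < j)%N ->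
  bracket (fun k => d (tperm i j k)) e (swap x i j) y =
    swap_sign K d i j *: bracket d e x y.
Proof.
move=> hx ij; rewrite scaler_sumr; apply: eq_bigr => k _.
rewrite total_tperm !act_atE (ad_skew _ hx ij).
have := wedge_multilinear gr (twist y) k (swap_sign K d i j) (ad x (y k)) 0.
rewrite addr0 => ->; rewrite (multilinear0 (@wedge_multilinear _ _ gr _) (upd_eq _ _ _)).
by rewrite addr0 !scalerA mulrC.
Qed.

Lemma bracket_skew_r d e x y (i j : 'I_m) : homog_at gr d x -> homog_at gr e y ->
  (i < j)%N ->
  bracket d (fun k => e (tperm i j k)) x (swap y i j) =
    swap_sign K e i j *: bracket d e x y.
Proof.
move=> hx hy ij; rewrite scaler_sumr /bracket.
(* The slot [k] of [y] is the slot [tperm i j k] of the exchanged tuple. *)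
rewrite (reindex_inj (@perm_inj _ (tperm i j))) /=.
apply: eq_bigr => k _.
have -> : act_at bra al x (swap y i j) (tperm i j k) =
    swap (act_at bra al x y k) i j.
  apply/ffunP=> l; rewrite !ffunE tpermK.
  by rewrite -(inj_eq (@perm_inj _ (tperm i j)) l) tpermK.
rewrite (wedge_super_skew (act_at_homog k hx hy) ij) !scalerA !swap_signE.
by rewrite mulrN mulNr -!signr_addb shift_swap_sign.
Qed.

(** The first extension, in [x], is made for each [y] and formal degree [e]; the
    second one, in [y], is then made for each fixed element [u] of the exterior
    power in place of [x]. This order avoids any choice of parity for [u]. *)
Lemma bracket_exists : exists br : W -> W -> W,
  [/\ forall v, linear (br^~ v), forall u, linear (br u)
    & is_induced_bracket bra al br].
Proof.
have /choice[g gP] (ey : ('I_m -> bool) * {ffun 'I_m -> N}) : exists g : W -> W,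
    linear g /\ forall d x, homog_at gr d x -> g (w x) = bracket d ey.1 x ey.2.
  apply: (superext_lift_homog grN) => [d|d x i j hx ij]; last exact: bracket_skew_l.
  exact: bracket_multilinear_l.
have gl ey : linear (g ey) by case: (gP ey).
have gw e y d x : homog_at gr d x -> g (e, y) (w x) = bracket d e x y.
  by case: (gP (e, y)) => _; apply.
have /choice[h hP] u : exists h : W -> W,
    linear h /\ forall e y, homog_at gr e y -> h (w y) = g (e, y) u.
  apply: (superext_lift_homog grN (G := fun e y => g (e, y) u)) => [e|e y i j hy ij].
    move=> y i a v v'; move: u; apply: (linear_eq_homog grN) => //.
    - move=> b u u'; rewrite !gl !scalerDr !scalerA addrACA; congr (_ + _ + _).
      by rewrite mulrC.
    - move=> d x hx; rewrite !(gw _ _ _ _ hx).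
      exact: bracket_multilinear_r.
  move: u; apply: (linear_eq_homog grN) => //.
  - by move=> b u u'; rewrite gl scalerDr !scalerA mulrC.
  - by move=> d x hx; rewrite !(gw _ _ _ _ hx); exact: bracket_skew_r.
have hl u : linear (h u) by case: (hP u).
have hw u e y : homog_at gr e y -> h u (w y) = g (e, y) u.
  by case: (hP u) => _; apply.
exists h; split=> // [v a u u'|d e x y hx hy]; last first.
  by rewrite (hw _ _ _ hy) (gw _ _ _ _ hx).
move: v; apply: (linear_eq_homog grN) => //.
- move=> b v v'; rewrite !hl !scalerDr !scalerA addrACA; congr (_ + _ + _).
  by rewrite mulrC.
- by move=> e y hy; rewrite !(hw _ _ _ hy) gl.
Qed.

Lemma twist_exists : exists alt : W -> W, linear alt /\ is_induced_twist al alt.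
Proof.
have [|d x i j hx ij|g [[gl gw] _]] :=
  @superext_universal _ _ gr m W (fun x => w (twist x)).
- by move=> x i a u v; rewrite !twist_upd linearP wedge_multilinear.
- by rewrite twist_swap (wedge_super_skew (twist_homog hx) ij).
by exists g.
Qed.

(** * The Hom-Leibniz identity *)

Section Identity.
Variables (br : {bilinear W -> W -> W}) (alt : {linear W -> W}).
Hypothesis brP : is_induced_bracket bra al br.
Hypothesis altP : is_induced_twist al alt.

(** In the summand (i, j) the operator of [y] acts on the slot [j] first, and that
    of [x] then acts on the slot [i]; when j < i it passes the operator of [y] as
    well. For i <> j the entries involve [y] only through ad_(alpha y), which
    makes the wedge symmetric under exchanging (x, i) and (y, j). *)
Lemma bracket_bracket d e f x y z :
  homog_at gr d x -> homog_at gr e y -> homog_at gr f z ->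
  br (w (twist x)) (br (w y) (w z)) =
    \sum_(j < m) \sum_(i < m)
       (-1) ^+ ((total e && total_lt f j)
                (+) (total d && (total_lt f i (+) ((j < i)%N && total e))))
       *: (if i == j then w (upd (twist (twist z)) j (ad (twist x) (ad y (z j))))
           else w (upd (upd (twist (twist z)) j (ad (twist y) (al (z j))))
                       i (ad (twist x) (al (z i))))).
Proof.
move=> hx hy hz; rewrite (brP hy hz) linear_sumr; apply: eq_bigr => j _.
rewrite linearZr_LR (brP (twist_homog hx) (act_at_homog j hy hz)) scaler_sumr.
apply: eq_bigr => i _; rewrite scalerA -signr_addb.
rewrite total_lt_shift_deg; congr (_ *: _).
rewrite !act_atE twist_upd ad_twist ffunE.
by case: eqP => [->|_]; rewrite ?upd_upd // ffunE.
Qed.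

Lemma leibniz_wedge d e f x y z :
  homog_at gr d x -> homog_at gr e y -> homog_at gr f z ->
  br (br (w x) (w y)) (alt (w z)) =
    br (alt (w x)) (br (w y) (w z))
      - (-1) ^+ (total d && total e) *: br (alt (w y)) (br (w x) (w z)).
Proof.
move=> hx hy hz; rewrite !altP -!/(twist _).
rewrite (bracket_bracket hx hy hz) (bracket_bracket hy hx hz).
(* Now the slot of [x] is the inner index [i] in both double sums. *)
rewrite [X in _ *: X]exchange_big /=.
rewrite (brP hx hy) linear_sumlz scaler_sumr -sumrB.
(* Only the terms where both operators act on the same slot remain. *)
transitivity (\sum_(j < m) (-1) ^+ ((total d (+) total e) && total_lt f j) *:
   (w (upd (twist (twist z)) j (ad (twist x) (ad y (z j))))
    - (-1) ^+ (total d && total e) *: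
      w (upd (twist (twist z)) j (ad (twist y) (ad x (z j)))))).
  under eq_bigr => i _.
    rewrite linearZl_LR (brP (act_at_homog i hx hy) (twist_homog hz)) scaler_sumr.
    rewrite total_shift_deg.
  over.
  rewrite exchange_big; apply: eq_bigr => j _.
  have -> : w (upd (twist (twist z)) j (ad (twist x) (ad y (z j))))
    - (-1) ^+ (total d && total e) *:
      w (upd (twist (twist z)) j (ad (twist y) (ad x (z j))))
    = w (upd (twist (twist z)) j (\sum_(i < m) (-1) ^+ (total d && total_lt e i)
         *: ad (act_at bra al x y i) (al (z j)))).
    rewrite (ad_commutator hx hy (hz j)) -scaleNr [in RHS]addrC -[in RHS]scaleNr.
    by rewrite (wedge_multilinear gr) addrC.
  rewrite (multilinear_sum _ _ _ _ (@wedge_multilinear _ _ gr _)) scaler_sumr.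
  by apply: eq_bigr => i _; rewrite !scalerA mulrC act_atE ffunE.
apply: eq_bigr => j _; rewrite scaler_sumr -sumrB (bigD1 j) //= big1 => [|i ij].
  rewrite !eqxx ltnn addr0 scalerBr !scalerA -!signr_addb.
  by congr (_ *: _ - _ *: _); congr (_ ^+ _); congr nat_of_bool;
    case: (total d) (total e) (total_lt f j) => [] [] [].
(* For i <> j exactly one of i < j and j < i holds, so the two signs differ by
   the factor (-1)^(|x||y|). *)
rewrite [j == i]eq_sym (negPf ij) [upd (upd _ i _) j _]updC // scalerA -signr_addb.
apply/eqP; rewrite subr_eq0; apply/eqP; congr (_ ^+ _ *: _); congr nat_of_bool.
move: ij; rewrite -val_eqE.
by case: ltngtP => // _ _;
  case: (total d) (total e) (total_lt f j) (total_lt f i) => [] [] [] [].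
Qed.

(** The identity is linear in each argument, so it follows from the case of
    wedges of homogeneous vectors, which span the homogeneous parts. *)
Lemma induced_hom_leibniz : hom_leibniz_superalgebra (superext_gr gr m) br alt.
Proof.
have sub (s : bool) : subspace_prop (superext_gr gr m s) by exact: lspan_subspace.
split.
- exact: superext_is_grading.
- move=> s t u v hu hv; elim: hu => [|a _ u' [d x hx <-] _ IH].
    by rewrite linear0l; exact: (sub _).1.
  rewrite linearPl; apply: (sub _).2 => // {u' IH}.
  elim: hv => [|b _ v' [e y hy <-] _ IH].
    by rewrite linear0r; exact: (sub _).1.
  rewrite linearPr; apply: (sub _).2 => //.
  rewrite (brP hx hy); apply: lspan_sum => i.
  exists (shift_deg e i (total d)); first exact: act_at_homog.
  exact: total_shift_deg.
- move=> s u; elim=> [|a _ v [d x hx <-] _ IH].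
    by rewrite linear0; exact: (sub _).1.
  rewrite linearP; apply: (sub _).2 => //; rewrite altP; apply: lspan_gen.
  by exists d => //; exact: twist_homog.
have comb (a c : K) (A A' B B' C C' : W) : A = B - c *: C -> A' = B' - c *: C' ->
    a *: A + A' = (a *: B + B') - c *: (a *: C + C').
  move=> -> ->; rewrite [c *: (_ + _)]scalerDr opprD addrACA; congr (_ + _).
  by rewrite scalerBr !scalerA mulrC.
move=> s t r u v z hu hv hz.
elim: hu => [|a _ u' [d x hx <-] _ IH].
  by rewrite !(linear0 alt, linear0l, linear0r) scaler0 subr0.
rewrite !(linearP alt, linearPl, linearPr); apply: (comb) IH => {u'}.
elim: hv => [|b _ v' [e y hy <-] _ IH].
  by rewrite !(linear0 alt, linear0l, linear0r) scaler0 subr0.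
rewrite !(linearP alt, linearPl, linearPr); apply: (comb) IH => {v'}.
elim: hz => [|c _ z' [f x' hx' _] _ IH].
  by rewrite !(linear0 alt, linear0l, linear0r) scaler0 subr0.
rewrite !(linearP alt, linearPl, linearPr); apply: (comb) IH.
exact: leibniz_wedge hx hy hx'.
Qed.

End Identity.
End Bracket.

(** * The theorem *)

Lemma bilinear_of (K : fieldType) (U V W : lmodType K) (h : U -> V -> W) :
  (forall v, linear (h^~ v)) -> (forall u, linear (h u)) ->
  exists br : {bilinear U -> V -> W}, br = h :> (U -> V -> W).
Proof.
move=> hl hr.
pose B := bilinear_isBilinear.Build K U V W *:%R *:%R h (hl, hr).
by exists (HB.pack_for {bilinear U -> V -> W} h B).
Qed.

Lemma linear_of (K : fieldType) (U V : lmodType K) (h : U -> V) :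
  linear h -> exists g : {linear U -> V}, g = h :> (U -> V).
Proof.
move=> hl; pose B := GRing.isLinear.Build K U V *:%R h hl.
by exists (HB.pack_for {linear U -> V} h B).
Qed.

Theorem proposition4p7 (K : closedFieldType) (charK : [pchar K] =i pred0)
    (N : lmodType K) (gr : bool -> N -> Prop) (m : nat)
    (bra : {ffun 'I_m.+1 -> N} -> N) (al : {linear N -> N})
    (HN : hom_nambu_lie_superalgebra gr bra al) :
  (exists (br : {bilinear superext gr m -> superext gr m -> superext gr m})
          (alt : {linear superext gr m -> superext gr m}),
      is_induced_bracket bra al br /\ is_induced_twist al alt)
  /\ (forall (br : {bilinear superext gr m -> superext gr m -> superext gr m})
             (alt : {linear superext gr m -> superext gr m}),
      is_induced_bracket bra al br -> is_induced_twist al alt ->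
      hom_leibniz_superalgebra (superext_gr gr m) br alt).
Proof.
split; last by move=> br alt; exact: induced_hom_leibniz.
have [h [hl hr hP]] := bracket_exists HN; have [br E] := bilinear_of hl hr.
have [k [kl kP]] := twist_exists HN; have [alt F] := linear_of kl.
by exists br, alt; rewrite E F.
Qed.
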